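(* Let $\emptyset\neq\mathcal{Y}\subseteq\mathbb{R}^n$ and let $\mathbf{\Phi}:\mathcal{Y}\to\overline{I(\mathbb{R})}$ be an interval-valued function such that $\mathbf{\Phi}(u)$ is finite (i.e. $\mathbf{\Phi}(u)\in I(\mathbb{R})$) for some $u\in\mathcal{Y}$. Then the following three statements are equivalent: (a) $\mathbf{\Phi}$ is $gH$-weak subdifferentiable at $u$. (b) $\mathbf{\Phi}$ is $gH$-lower Lipschitz at $u$. (c) $\mathbf{\Phi}$ is $gH$-lower locally Lipschitz at $u$, and there exist a number $p\ge0$ and an interval $\mathbf{Q}\in I(\mathbb{R})$ such that $-p\|y\|\oplus\mathbf{Q}\preceq\mathbf{\Phi}(y)$ for all $y\in\mathcal{Y}$.
   Context: $I(\mathbb{R})$ is the set of compact intervals $\mathbf{X}=[\underline{x},\overline{x}]$, $\underline{x}\le\overline{x}$; a real number $c$ is identified with $[c,c]$; $\overline{I(\mathbb{R})}=I(\mathbb{R})\cup\{-\infty,+\infty\}$, with $-\infty\preceq\mathbf{X}\preceq+\infty$ for every $\mathbf{X}\in I(\mathbb{R})$, $-\infty$ not dominating from above any element of $I(\mathbb{R})$, and $\pm\infty\ominus_{gH}\mathbf{X}=\pm\infty$ for $\mathbf{X}\in I(\mathbb{R})$. Operations: $\mathbf{X}\oplus\mathbf{Y}=[\underline{x}+\underline{y},\overline{x}+\overline{y}]$; $\lambda\odot\mathbf{X}=[\min\{\lambda\underline{x},\lambda\overline{x}\},\max\{\lambda\underline{x},\lambda\overline{x}\}]$ for $\lambda\in\mathbb{R}$;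 $gH$-difference $\mathbf{X}\ominus_{gH}\mathbf{Y}=[\min\{\underline{x}-\underline{y},\overline{x}-\overline{y}\},\max\{\underline{x}-\underline{y},\overline{x}-\overline{y}\}]$. Order: $\mathbf{X}\preceq\mathbf{Y}$ iff $\underline{x}\le\underline{y}$ and $\overline{x}\le\overline{y}$. For $\widehat{\mathbf{G}}=(\mathbf{G}_1,\dots,\mathbf{G}_n)\in I(\mathbb{R})^n$ and $d\in\mathbb{R}^n$, $\widehat{\mathbf{G}}^\top\odot d=\bigoplus_{i=1}^n d_i\odot\mathbf{G}_i$. $\mathbb{R}_+=[0,\infty)$ and $\|\cdot\|$ is the Euclidean norm. $\mathbf{\Phi}$ is $gH$-weak subdifferentiable at $u$ if there exists $(\widehat{\mathbf{G}},c)\in I(\mathbb{R})^n\times\mathbb{R}_+$ with $\widehat{\mathbf{G}}^\top\odot(y-u)\ominus_{gH}c\|y-u\|\preceq\mathbf{\Phi}(y)\ominus_{gH}\mathbf{\Phi}(u)$ for all $y\in\mathcal{Y}$. $\mathbf{\Phi}$ is $gH$-lower locally Lipschitz at $u$ if there exist $L\ge0$ and a neighbourhood $\mathcal{N}(u)$ of $u$ such that $-L\|y-u\|\preceq\mathbf{\Phi}(y)\ominus_{gH}\mathbf{\Phi}(u)$ for all $y\in\mathcal{N}(u)$ (with $y\in\mathcal{Y}$). It is $gH$-lower Lipschitz at $u$ if there is $L\ge0$ such that this inequality holds for all $y\in\mathcal{Y}$. *)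

(* Defs.v *)
From HB Require Import structures.
From mathcomp Require Import all_boot all_order all_algebra.
From mathcomp Require Import all_classical all_reals all_analysis.

Set Implicit Arguments.
Unset Strict Implicit.
Unset Printing Implicit Defensive.

Import Order.TTheory GRing.Theory Num.Theory.
Import numFieldNormedType.Exports.

Local Open Scope classical_set_scope.
Local Open Scope ring_scope.

(* The library's norm on ['rV_n] is the sup norm; the Euclidean norm is not
   provided.  Both induce the same topology, so [nbhs] can be used as is. *)
Definition enorm (R : realType) (n : nat) (x : 'rV[R]_n) : R :=
  Num.sqrt (\sum_(i < n) x 0 i ^+ 2).

(* The library type [interval R] also contains open, unbounded and empty
   intervals, hence a dedicated type for nonempty compact intervals. *)
Record citv (R : realType) := CItv {
  lo : R;
  hi : R;
  lo_le_hi : lo <= hi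
}.

Section CItvOperations.
Context {R : realType}.
Implicit Types (X Y : citv R) (c : R).

Definition citv_pt c : citv R := CItv (lexx c).

Lemma citv_add_subproof X Y : lo X + lo Y <= hi X + hi Y.
Proof. by apply: lerD; apply: lo_le_hi. Qed.

Definition citv_add X Y : citv R := CItv (citv_add_subproof X Y).

Lemma citv_minmax_subproof (a b : R) : Num.min a b <= Num.max a b.
Proof. by rewrite ge_min le_max lexx. Qed.

Definition citv_scale c X : citv R :=
  CItv (citv_minmax_subproof (c * lo X) (c * hi X)).

Definition gHsub X Y : citv R :=
  CItv (citv_minmax_subproof (lo X - lo Y) (hi X - hi Y)).

Definition citv_le X Y : bool := (lo X <= lo Y) && (hi X <= hi Y).

Definition citv_dot (n : nat) (G : 'I_n -> citv R) (d : 'rV[R]_n) : citv R :=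
  \big[citv_add/citv_pt 0]_(i < n) citv_scale (d 0 i) (G i).

End CItvOperations.

Inductive eitv (R : realType) :=
  | IFin of citv R
  | IPInf
  | INInf.
Arguments IPInf {R}.
Arguments INInf {R}.

Section ExtendedIntervals.
Context {R : realType}.
Implicit Types X Y : eitv R.

Definition is_ifin X : bool := if X is IFin _ then true else false.

Definition eitv_le X Y : bool :=
  match X, Y with
  | INInf, _ => true
  | _, IPInf => true
  | IFin A, IFin B => citv_le A B
  | _, _ => false
  end.

(* The gH-difference is only meaningful for a finite subtrahend.  The last
   branch is a default value; it is never reached below when [Phi u] is
   finite, and it makes the notions below fail at points [u] of the domain
   where [Phi u] is infinite. *)
Definition egHsub X Y : eitv R :=
  match X, Y with
  | IFin A, IFin B => IFin (gHsub A B)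
  | IPInf, IFin _ => IPInf
  | INInf, IFin _ => INInf
  | _, _ => INInf
  end.

End ExtendedIntervals.

(* A function with domain [D] is a total function on ['rV_n] of which only the
   values on [D] are ever used. *)
Section Notions.
Context {R : realType} {n : nat}.
Variables (D : set 'rV[R]_n) (Phi : 'rV[R]_n -> eitv R) (u : 'rV[R]_n).

Definition gH_weak_subdifferentiable : Prop :=
  exists (G : 'I_n -> citv R) (c : R), 0 <= c /\
    forall y, D y ->
      eitv_le
        (IFin (gHsub (citv_dot G (y - u)) (citv_pt (c * enorm (y - u)))))
        (egHsub (Phi y) (Phi u)).

Definition gH_lower_lipschitz : Prop :=
  exists L : R, 0 <= L /\
    forall y, D y ->
      eitv_le (IFin (citv_pt (- L * enorm (y - u)))) (egHsub (Phi y) (Phi u)).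

Definition gH_lower_locally_lipschitz : Prop :=
  exists (L : R) (N : set 'rV[R]_n), [/\ 0 <= L, nbhs u N &
    forall y, N y -> D y ->
      eitv_le (IFin (citv_pt (- L * enorm (y - u)))) (egHsub (Phi y) (Phi u))].

End Notions.

(* Main.v *)
(** A bound [a (+) X <= Phi y] is a pair of lower bounds on the endpoints of
    [Phi y], and [a <= Phi y (-)gH X] says the same thing.  Thus a weak
    subgradient [(G, c)] yields a Lipschitz bound because [G^T . d] is at least
    a multiple of [- ||d||], and conversely [(0, L)] is a weak subgradient.  A
    local Lipschitz bound extends outside a ball of radius [e] because there the
    constants of the affine minorant are absorbed by [||y - u|| >= e]. *)
Require Import Defs.
From mathcomp Require Import all_boot all_order all_algebra.
From mathcomp Require Import all_classical all_reals all_analysis.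
From mathcomp Require Import lra.

Import Order.TTheory GRing.Theory Num.Theory.
Import numFieldNormedType.Exports.

Local Open Scope classical_set_scope.
Local Open Scope ring_scope.

Section EuclideanNorm.
Context {R : realType} {n : nat}.
Implicit Types x y : 'rV[R]_n.

Lemma enorm_ge0 x : 0 <= enorm x.
Proof. exact: sqrtr_ge0. Qed.

Lemma ler_coord_enorm x i : `|x 0 i| <= enorm x.
Proof.
rewrite -sqrtr_sqr; apply: ler_wsqrtr.
by rewrite (bigD1 i) //= lerDl; apply: sumr_ge0 => j _; apply: sqr_ge0.
Qed.

Lemma enorm_le_l1 x : enorm x <= \sum_(i < n) `|x 0 i|.
Proof.
have s0 : 0 <= \sum_(i < n) `|x 0 i| by apply: sumr_ge0.
rewrite -[leRHS]ger0_norm // -sqrtr_sqr; apply: ler_wsqrtr.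
(* Only one factor of the squared sum is expanded: termwise, [|x_i|^2 <= |x_i| * sum_j |x_j|]. *)
rewrite expr2 mulr_suml; apply: ler_sum => i _.
rewrite -real_normK ?num_real // expr2 ler_wpM2l //.
by rewrite (bigD1 i) //= lerDl; apply: sumr_ge0.
Qed.

(* The factor [n] is not optimal, but it spares Cauchy-Schwarz. *)
Lemma enormD_le x y : enorm (x + y) <= n%:R * (enorm x + enorm y).
Proof.
apply: (le_trans (enorm_le_l1 _)).
have -> : n%:R * (enorm x + enorm y) = \sum_(i < n) (enorm x + enorm y).
  by rewrite sumr_const card_ord mulr_natl.
apply: ler_sum => i _.
by rewrite mxE (le_trans (ler_normD _ _)) // lerD // ler_coord_enorm.
Qed.

Lemma enormN x : enorm (- x) = enorm x.
Proof. by congr Num.sqrt; apply: eq_bigr => i _; rewrite mxE sqrrN. Qed.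

(** Neighbourhoods come from sup-norm balls. The Euclidean ball of the same radius lies inside,
    since [enorm] dominates every coordinate. *)
Lemma nbhs_enorm {x} {N : set 'rV[R]_n} : nbhs x N ->
  exists2 e, 0 < e & forall y, enorm (y - x) < e -> N y.
Proof.
move=> /nbhs_ballP[e /= e0 eN]; exists e => // y yx; apply: eN; split=> // i j.
rewrite ord1 -ball_normE /ball_ /= distrC.
by have := ler_coord_enorm (y - x) j; rewrite !mxE => /le_lt_trans; apply.
Qed.

End EuclideanNorm.

Section IntervalOrder.
Context {R : realType}.
Implicit Types (X Y Z : eitv R) (A B : citv R) (a b : R).

Lemma eitv_le_trans X Y Z : eitv_le X Y -> eitv_le Y Z -> eitv_le X Z.
Proof.
case: X Y Z => [A||] [B||] [C||] //= /andP[l1 h1] /andP[l2 h2].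
by apply/andP; split; [apply: le_trans l2|apply: le_trans h2].
Qed.

(** Lying below the minimum of the two endpoint differences already implies lying below their
    maximum, so what remains is one bound per endpoint. For infinite [X] both sides have the same
    truth value. *)
Lemma le_egHsub_pt a X A :
  eitv_le (IFin (citv_pt a)) (egHsub X (IFin A)) =
  eitv_le (IFin (citv_add (citv_pt a) A)) X.
Proof.
case: X => [B||] //=; rewrite /citv_le /= le_min le_max !lerBrDr.
by case: (a + lo A <= lo B); case: (a + hi A <= hi B).
Qed.

Lemma citv_le_add2 a b A B : a + lo A <= b + lo B -> a + hi A <= b + hi B ->
  eitv_le (IFin (citv_add (citv_pt a) A)) (IFin (citv_add (citv_pt b) B)).
Proof. by move=> l h; apply/andP; split. Qed.

Lemma le_gHsub_pt a b A :
  a + b <= lo A -> eitv_le (IFin (citv_pt a)) (IFin (gHsub A (citv_pt b))).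
Proof.
move=> abA; have hA := le_trans abA (lo_le_hi A).
by rewrite /= /citv_le /= le_min le_max !lerBrDr abA hA.
Qed.

Lemma citv_eq A B : lo A = lo B -> hi A = hi B -> A = B.
Proof.
case: A B => [a1 a2 p] [b1 b2 q] /= e1 e2.
by move: p q; rewrite e1 e2 => p q; congr CItv; apply: Prop_irrelevance.
Qed.

Lemma gHsub_pt a b : gHsub (citv_pt a) (citv_pt b) = citv_pt (a - b).
Proof. by apply: citv_eq => /=; rewrite ?minxx ?maxxx. Qed.

Lemma citv_dot0 {n : nat} (d : 'rV[R]_n) :
  citv_dot (fun=> citv_pt 0) d = citv_pt 0.
Proof.
rewrite /citv_dot; elim/big_rec: _ => //= i A _ ->.
by apply: citv_eq => /=; rewrite !mulr0 ?minxx ?maxxx addr0.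
Qed.

(** The lower endpoint of each summand is [d_i * lo (G i)] or [d_i * hi (G i)], and
    [|d_i| <= enorm d]. *)
Lemma lo_citv_dot_ge {n : nat} (G : 'I_n -> citv R) (d : 'rV[R]_n) :
  - ((\sum_(i < n) (`|lo (G i)| + `|hi (G i)|)) * enorm d) <= lo (citv_dot G d).
Proof.
rewrite /citv_dot mulr_suml; elim/big_rec2: _ => [|i A s _ sA].
  by rewrite oppr0.
rewrite /= opprD lerD //.
have bnd x : `|x| <= `|lo (G i)| + `|hi (G i)| ->
    - ((`|lo (G i)| + `|hi (G i)|) * enorm d) <= d 0 i * x.
  move=> xG; apply: lerNnormlW; rewrite normrM mulrC.
  by rewrite ler_pM // ler_coord_enorm.
by rewrite le_min !bnd // ?lerDl ?lerDr.
Qed.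

End IntervalOrder.

Section Equivalences.
Context {R : realType} {n : nat}.
Context {D : set 'rV[R]_n} {Phi : 'rV[R]_n -> eitv R} {u : 'rV[R]_n}.

Lemma weak_subdifferentiable_lower_lipschitz :
  gH_weak_subdifferentiable D Phi u <-> gH_lower_lipschitz D Phi u.
Proof.
split=> [[G [c [c0 Gc]]]|[L [L0 Lip]]].
  pose M : R := \sum_(i < n) (`|lo (G i)| + `|hi (G i)|).
  have M0 : 0 <= M by apply: sumr_ge0 => i _; apply: addr_ge0.
  (* [M] pays for the product with [G], and [c] for the subtracted norm term. *)
  exists (M + c); split=> [|y Dy]; first exact: addr_ge0.
  apply: eitv_le_trans (Gc y Dy); apply: le_gHsub_pt.
  rewrite (le_trans _ (lo_citv_dot_ge G (y - u))) // -/M.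
  by rewrite -mulrDl opprD addrNK mulNr.
exists (fun=> citv_pt 0), L; split=> // y Dy.
by rewrite citv_dot0 gHsub_pt sub0r -mulNr; apply: Lip.
Qed.

Lemma lower_lipschitz_minorant {A : citv R} : Phi u = IFin A ->
  gH_lower_lipschitz D Phi u ->
  exists (p : R) (Q : citv R), 0 <= p /\
    forall y, D y ->
      eitv_le (IFin (citv_add (citv_pt (- p * enorm y)) Q)) (Phi y).
Proof.
move=> PhiuA [L [L0 Lip]].
(* The factor [n] comes from [enormD_le], which splits [enorm (y - u)]; the share of [enorm u] is
   constant and goes into [Q]. *)
exists (L * n%:R), (citv_add (citv_pt (- (L * n%:R) * enorm u)) A).
split=> [|y Dy]; first by rewrite mulr_ge0.
have := Lip y Dy; rewrite PhiuA le_egHsub_pt; apply: eitv_le_trans.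
have := ler_wpM2l L0 (enormD_le y (- u)); rewrite enormN => yu.
by apply: citv_le_add2 => /=; rewrite addrA lerD2r !mulNr -opprD lerN2;
  rewrite -mulrDr -mulrA.
Qed.

Lemma local_lower_lipschitz_extends {A Q : citv R} {p : R} :
  Phi u = IFin A -> 0 <= p ->
  (forall y, D y ->
    eitv_le (IFin (citv_add (citv_pt (- p * enorm y)) Q)) (Phi y)) ->
  gH_lower_locally_lipschitz D Phi u -> gH_lower_lipschitz D Phi u.
Proof.
move=> PhiuA p0 minor [L [N [L0 uN Lip]]].
have [e e0 eN] := nbhs_enorm uN.
(* [K] collects all the constants of the comparison away from [u], for both endpoints at once; the
   last term arises from splitting [y] as [(y - u) + u]. *)
pose K : R := `|lo A - lo Q| + `|hi A - hi Q| + p * n%:R * enorm u.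
have K0 : 0 <= K by rewrite !addr_ge0 // !mulr_ge0 // enorm_ge0.
have [k k0 Kk] : exists2 k, 0 <= k & forall d, e <= d -> K <= k * d.
  exists (K / e) => [|d ed]; first by rewrite divr_ge0 // ltW.
  by rewrite -mulrA ler_peMr // mulrC ler_pdivlMr // mul1r.
have pn0 : 0 <= p * n%:R by rewrite mulr_ge0.
(* [L] suffices within distance [e] of [u] and [k + p * n] beyond it, so their sum serves in both
   cases. *)
exists (L + (k + p * n%:R)); split=> [|y Dy]; first by rewrite !addr_ge0.
have d0 := enorm_ge0 (y - u).
rewrite PhiuA le_egHsub_pt.
have [yu|yu] := ltP (enorm (y - u)) e.
  have := Lip y (eN y yu) Dy; rewrite PhiuA le_egHsub_pt; apply: eitv_le_trans.
  by apply: citv_le_add2; rewrite lerD2r ler_wpM2r // lerN2 lerDl addr_ge0.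
apply: eitv_le_trans (minor y Dy).
have Ld : 0 <= L * enorm (y - u) by rewrite mulr_ge0.
have yE : p * enorm y <= p * n%:R * enorm (y - u) + p * n%:R * enorm u.
  by rewrite -mulrDr -mulrA ler_wpM2l // -[y in leLHS](subrK u) enormD_le.
have loAQ := ler_norm (lo A - lo Q); have hiAQ := ler_norm (hi A - hi Q).
have loAQ0 := normr_ge0 (lo A - lo Q); have hiAQ0 := normr_ge0 (hi A - hi Q).
have := Kk _ yu; rewrite /K => {}Kk.
by apply: citv_le_add2; rewrite !mulNr !mulrDl; lra.
Qed.

End Equivalences.

Theorem theorem4 (R : realType) (n : nat) (D : set 'rV[R]_n)
    (D_neq0 : D !=set0) (Phi : 'rV[R]_n -> eitv R) (u : 'rV[R]_n)
    (Du : D u) (Phiu_fin : is_ifin (Phi u)) :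
  (gH_weak_subdifferentiable D Phi u <-> gH_lower_lipschitz D Phi u) /\
  (gH_lower_lipschitz D Phi u <->
   (gH_lower_locally_lipschitz D Phi u /\
    exists (p : R) (Q : citv R), 0 <= p /\
      forall y, D y ->
        eitv_le (IFin (citv_add (citv_pt (- p * enorm y)) Q)) (Phi y))).
Proof.
split; first exact: weak_subdifferentiable_lower_lipschitz.
have [A PhiuA] : exists A, Phi u = IFin A.
  by case: (Phi u) Phiu_fin => // A _; exists A.
split=> [Lip|[loc [p [Q [p0 minor]]]]].
  split; last exact: lower_lipschitz_minorant PhiuA Lip.
  have [L [L0 LipL]] := Lip.
  by exists L, setT; split=> // [|y _]; [exact: filterT|exact: LipL].
exact: local_lower_lipschitz_extends PhiuA p0 minor loc.
Qed.
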